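(* Let $k\ge1$. Let $X$ be a smooth vector field on $\mathbb{S}^1$ whose flow consists of traces (restrictions to $\mathbb{S}^1=\partial D^2$) of holomorphic diffeomorphisms of $D^2$. Then for any $u\in H^{\frac12}(\mathbb{S}^1,\mathbb{R}^k)$ there holds $$\langle\mathcal{V}_{\frac12}(u),X\rangle=0.$$
   Context: $D^2\subset\mathbb{C}$ is the open unit disc and $\partial D^2=\mathbb{S}^1\simeq\mathbb{R}/2\pi\mathbb{Z}$; smooth vector fields on $\mathbb{S}^1$ are identified with smooth functions $X:\mathbb{S}^1\to\mathbb{R}$, and $u'$ is the derivative in the angular variable. The holomorphic diffeomorphisms of $D^2$ are the maps $z\mapsto\mu\frac{z-a}{\bar az-1}$ with $\mu,a\in\mathbb{C}$, $|\mu|=1$, $|a|<1$; they extend to diffeomorphisms of $\overline{D^2}$. For a distribution $f$ on $\mathbb{S}^1$, $\widehat f(n)=\frac1{2\pi}\langle f,e^{-inx}\rangle$, and $(-\Delta)^s f$ is defined by $\widehat{(-\Delta)^s f}(n)=|n|^{2s}\widehat f(n)$, $n\in\mathbb{Z}$. For $u\in C^\infty(\mathbb{S}^1,\mathbb{R}^k)$ set $\mathcal{V}_{\frac12}(u)=(-\Delta)^{\frac12}u\cdot u'$. For $u\in H^{\frac12}(\mathbb{S}^1,\mathbb{R}^k)$, $\mathcal{V}_{\frac12}(u)$ is the distribution $\lim_{n\to\infty}(-\Delta)^{\frac12}u_n\cdot u_n'$, the limit being taken in $\mathscr{D}'(\mathbb{S}^1)$, where $(u_n)$ is any sequence of smooth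 maps converging to $u$ in $H^{\frac12}(\mathbb{S}^1,\mathbb{R}^k)$ (the limit exists and does not depend on the sequence). *)

(* Defs.v *)
From HB Require Import structures.
From mathcomp Require Import all_boot all_order all_algebra.
From mathcomp Require Import complex.
From mathcomp Require Import all_classical all_reals all_analysis.

Set Implicit Arguments.
Unset Strict Implicit.
Unset Printing Implicit Defensive.

Import Order.TTheory GRing.Theory Num.Theory.
Import numFieldNormedType.Exports.

Local Open Scope classical_set_scope.
Local Open Scope complex_scope.
Local Open Scope ring_scope.

(* A function on the circle R/2piZ is a 2pi-periodic function on R. *)

Definition periodic2pi {R : realType} {V : Type} (f : R -> V) : Prop :=
  forall x, f (x + 2 * pi) = f x.

Definition smooth_circle {R : realType} (f : R -> R) : Prop :=
  periodic2pi f /\ forall n x, derivable (derive1n n f) x 1.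

Definition component {R : realType} {k : nat} (u : R -> 'rV[R]_k) (j : 'I_k) :
    R -> R :=
  fun x => u x 0 j.

Definition smooth_map {R : realType} {k : nat} (u : R -> 'rV[R]_k) : Prop :=
  forall j, smooth_circle (component u j).

(* Real distributions on the circle.  The values of T outside smooth_circle
   are irrelevant.  Continuity is for the Frechet topology given by the
   seminorms sup |phi^(i)|. *)
Definition is_distribution {R : realType} (T : (R -> R) -> R) : Prop :=
  (forall (a : R) phi psi, smooth_circle phi -> smooth_circle psi ->
     T (fun x => a * phi x + psi x) = a * T phi + T psi) /\
  (exists (C : R) (N : nat), forall phi (M : R), smooth_circle phi ->
     (forall i x, (i <= N)%N -> `|derive1n i phi x| <= M) -> `|T phi| <= C * M).

Definition fun_distr {R : realType} (f phi : R -> R) : R :=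
  \int[lebesgue_measure]_(x in `[0, 2 * pi]) (f x * phi x).

Definition cvg_distr {R : realType} (Tn : nat -> (R -> R) -> R)
    (T : (R -> R) -> R) : Prop :=
  forall phi, smooth_circle phi -> Tn n phi @[n --> \oo] --> T phi.

(* (2 pi)^-1 <T, e^(-inx)>, with T extended C-linearly to complex tests. *)
Definition fourier {R : realType} (T : (R -> R) -> R) (n : int) : R[i] :=
  (T (fun x => cos (n%:~R * x)) / (2 * pi)) -i*
  (T (fun x => sin (n%:~R * x)) / (2 * pi)).

(* S = (-Delta)^s T; note that 0 `^ r = 0 for r != 0. *)
Definition is_fracLap {R : realType} (s : R) (T S : (R -> R) -> R) : Prop :=
  forall n : int,
    fourier S n = (`|n%:~R : R| `^ (2 * s))%:C * fourier T n.

(* w = (-Delta)^(1/2) u . u' for a smooth map u; g is (-Delta)^(1/2) u. *)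
Definition is_V12_smooth {R : realType} {k : nat} (u : R -> 'rV[R]_k)
    (w : R -> R) : Prop :=
  exists g : R -> 'rV[R]_k,
    [/\ smooth_map g,
        forall j, is_fracLap 2^-1 (fun_distr (component u j))
                                  (fun_distr (component g j))
      & forall x, w x = \sum_(j < k) component g j x * derive1 (component u j) x].

Definition sobolev_norm2 {R : realType} {k : nat} (s : R)
    (u : R -> 'rV[R]_k) : \bar R :=
  (\sum_(j < k) \esum_(n in [set: int])
     ((1 + (n%:~R : R) ^+ 2) `^ s *
      (ComplexField.Normc.normc
         (fourier (fun_distr (component u j)) n)) ^+ 2)%:E)%E.

(* u represents an element of H^s(S^1, R^k), for s >= 0. *)
Definition sobolev {R : realType} {k : nat} (s : R) (u : R -> 'rV[R]_k) :
    Prop :=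
  [/\ periodic2pi u,
      forall j, measurable_fun setT (component u j),
      forall j, lebesgue_measure.-integrable `[0, 2 * pi]
                  (fun x => ((component u j x) ^+ 2)%:E)
    & (sobolev_norm2 s u < +oo)%E].

Definition sobolev_cvg {R : realType} {k : nat} (s : R)
    (un : nat -> R -> 'rV[R]_k) (u : R -> 'rV[R]_k) : Prop :=
  sobolev_norm2 s (fun x => un n x - u x) @[n --> \oo] --> 0%E.

(* T is the distribution V_(1/2)(u), for u in H^(1/2)(S^1, R^k). *)
Definition is_V12 {R : realType} {k : nat} (u : R -> 'rV[R]_k)
    (T : (R -> R) -> R) : Prop :=
  is_distribution T /\
  forall (un : nat -> R -> 'rV[R]_k) (wn : nat -> R -> R),
    (forall n, smooth_map (un n)) -> sobolev_cvg 2^-1 un u ->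
    (forall n, is_V12_smooth (un n) (wn n)) ->
    cvg_distr (fun n => fun_distr (wn n)) T.

Definition expi {R : realType} (x : R) : R[i] := cos x +i* sin x.

(* Holomorphic diffeomorphisms of the unit disc, extended to the closed disc. *)
Definition disc_diffeo {R : realType} (M : R[i] -> R[i]) : Prop :=
  exists mu a : R[i],
    [/\ `|mu| = 1, `|a| < 1
      & forall z : R[i], `|z| <= 1 -> M z = mu * ((z - a) / (a^* * z - 1))].

(* Phi is the lift to R of the flow on the circle of the vector field X. *)
Definition is_flow {R : realType} (X : R -> R) (Phi : R -> R -> R) : Prop :=
  (forall x, Phi 0 x = x) /\
  (forall t x : R, is_derive t 1 (fun s => Phi s x) (X (Phi t x))).

Definition flow_of_disc_diffeos {R : realType} (X : R -> R) : Prop :=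
  exists Phi : R -> R -> R, is_flow X Phi /\
    forall t, exists M, disc_diffeo M /\
      forall x, expi (Phi t x) = M (expi x).

(* Main.v *)
(* Disc automorphisms preserve cross ratios; differentiating the cross ratio of
   four points of the circle along the flow shows that X is a combination of
   1, cos and sin.  For a trigonometric polynomial u, put
   F := (-Delta)^(1/2) u + i u'.  Then F is a combination of e^(-inx) with
   n >= 1, so 2 (-Delta)^(1/2) u . u' = Im (F^2) only has frequencies at least 2
   and is orthogonal to X.  The Fourier partial sums of u converge to u in
   H^(1/2), so the pairing with X vanishes in the limit. *)
Require Import Defs.
From mathcomp Require Import all_boot all_order all_algebra.
From mathcomp Require Import complex ring lra.
From mathcomp Require Import all_classical all_reals all_analysis measurable_realfun.
Import Order.TTheory GRing.Theory Num.Theory.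
Import numFieldNormedType.Exports.
Local Open Scope classical_set_scope.
Local Open Scope complex_scope.
Local Open Scope ring_scope.

(** * Cross ratios under disc automorphisms *)

(** The cross ratio is cleared of denominators, so that coinciding points are allowed. On the closed
    disc a^* z = 1 would force |a| |z| = 1, against |a| < 1; so the Moebius denominators are nonzero
    and a rational identity remains. *)
Lemma disc_diffeo_cross_ratio (R : realType) (M : R[i] -> R[i])
    (z1 z2 z3 z4 : R[i]) :
  disc_diffeo M -> `|z1| <= 1 -> `|z2| <= 1 -> `|z3| <= 1 -> `|z4| <= 1 ->
  (M z1 - M z3) * (M z2 - M z4) * ((z1 - z4) * (z2 - z3)) =
  (M z1 - M z4) * (M z2 - M z3) * ((z1 - z3) * (z2 - z4)).
Proof.
move=> [mu [a [_ a1 Mz]]] h1 h2 h3 h4.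
have den z : `|z| <= 1 -> a^* * z - 1 != 0.
  move=> hz; rewrite subr_eq0; apply/eqP => az1.
  have : `|a^* * z| = 1 by rewrite az1 normr1.
  rewrite normrM norm_conjC => e.
  have : `|a| * `|z| <= `|a| * 1 by rewrite ler_wpM2l.
  by rewrite e mulr1 => /le_lt_trans /(_ a1); rewrite ltxx.
have d1 := den _ h1; have d2 := den _ h2.
have d3 := den _ h3; have d4 := den _ h4.
rewrite !Mz //; field.
by rewrite d1 d2 d3 d4.
Qed.

Lemma norm_expi (R : realType) (x : R) : `|expi x| = 1.
Proof. by rewrite normc_def /= cos2Dsin2 sqrtr1. Qed.

(** With x = q + p and y = q - p, the phase of the midpoint q factors out and leaves 2 i sin p. *)
Lemma expiB (R : realType) (x y : R) :
  expi x - expi y =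
  2 * 'i%C * (sin ((x - y) / 2))%:C * expi ((x + y) / 2).
Proof.
have -> : x = (x - y) / 2 + (x + y) / 2 by field.
set p := (x - y) / 2; set q := (x + y) / 2.
have -> : y = q - p by rewrite /p /q; field.
have -> : (p + q - (q - p)) / 2 = p by field.
have -> : (p + q + (q - p)) / 2 = q by field.
rewrite /expi cosD cosB sinD sinB.
apply/eqP; rewrite eq_complex /=; apply/andP; split; apply/eqP; ring.
Qed.

Lemma expi_neq0 (R : realType) (x : R) : expi x != 0.
Proof. by rewrite -normr_eq0 norm_expi oner_neq0. Qed.

Lemma expiD (R : realType) (x y : R) : expi (x + y) = expi x * expi y.
Proof. by rewrite /expi cosD sinD /GRing.mul/= [sin x * _ + _]addrC. Qed.

(* The form of the invariance of the cross ratio that only involves the real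
   lift phi, since expi x - expi y is 2 i sin ((x - y) / 2) times a phase. *)
Lemma disc_diffeo_sin_cross_ratio (R : realType) (M : R[i] -> R[i])
    (phi : R -> R) (x1 x2 x3 x4 : R) :
  disc_diffeo M -> (forall x, expi (phi x) = M (expi x)) ->
  let c x y := sin ((x - y) / 2) in
  let s x y := c (phi x) (phi y) in
  s x1 x3 * s x2 x4 * (c x1 x4 * c x2 x3) =
  s x1 x4 * s x2 x3 * (c x1 x3 * c x2 x4).
Proof.
move=> dM hphi c s.
have n1 (x : R) : `|expi x| <= 1 by rewrite norm_expi.
have := disc_diffeo_cross_ratio _ _ _ _ _ _ dM (n1 x1) (n1 x2) (n1 x3) (n1 x4).
rewrite -!hphi !expiB -!/(c _ _) -!/(s _ _).
(* [K] collects the phases of the left side and [eK] shows that the right side has the same ones: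
   however four angles are paired, the half-sums have the same total. The factor 16 i^4 comes from
   the four factors 2 i on each side. *)
set K := 16 * expi ((phi x1 + phi x3) / 2) * expi ((phi x2 + phi x4) / 2) *
         expi ((x1 + x4) / 2) * expi ((x2 + x3) / 2).
have eK : 16 * (expi ((phi x1 + phi x4) / 2) * expi ((phi x2 + phi x3) / 2)) *
         (expi ((x1 + x3) / 2) * expi ((x2 + x4) / 2)) = K.
  rewrite /K -[in RHS](mulrA 16) -[in RHS](mulrA _ (expi ((x1 + x4) / 2))) -!expiD.
  by congr (_ * expi _ * expi _); ring.
have i4 : 'i%C ^+ 4 = 1 :> R[i] by rewrite (exprM _ 2 2) sqr_i sqrrN expr1n.
have K0 : K != 0.
  by rewrite /K !mulf_neq0 ?expi_neq0 // pnatr_eq0.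
move=> E.
have {E} : K * 'i%C ^+ 4 * (s x1 x3 * s x2 x4 * (c x1 x4 * c x2 x3))%:C =
           K * 'i%C ^+ 4 * (s x1 x4 * s x2 x3 * (c x1 x3 * c x2 x4))%:C.
  rewrite -[in RHS]eK /K !rmorphM /=.
  by ring: E.
by rewrite i4 mulr1 => /(mulfI K0) /complexI.
Qed.

(** * Vector fields whose flow consists of disc automorphisms *)

Lemma flow_of_disc_diffeos_trig (R : realType) (X : R -> R) :
  flow_of_disc_diffeos X ->
  exists al be ga, X = fun x => al + be * cos x + ga * sin x.
Proof.
move=> [Phi [[Phi0 dPhi] hPhi]].
pose c (x y : R) := sin ((x - y) / 2).
pose S x y := fun t => c (Phi t x) (Phi t y).
have dS x y : is_derive (0 : R) 1 (S x y)
    (cos ((x - y) / 2) * ((X x - X y) / 2)).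
  have dx := dPhi 0 x; have dy := dPhi 0 y.
  have dd : is_derive (0 : R) 1 (fun t => (Phi t x - Phi t y) / 2)
      ((X x - X y) / 2).
    have -> : (fun t => (Phi t x - Phi t y) / 2) =
              2^-1 \*: (Phi^~ x - Phi^~ y).
      by apply/funext => t /=; rewrite /GRing.scale/= mulrC.
    apply: is_derive_eq.
    by rewrite !Phi0 /GRing.scale/= mulrC.
  have -> : S x y = sin \o (fun t => (Phi t x - Phi t y) / 2) by [].
  apply: is_derive_eq.
  by rewrite /= !Phi0 /GRing.scale/= mulrC.
have S0 x y : S x y 0 = c x y by rewrite /S !Phi0.
have dM (f g : R -> R) df dg : is_derive (0 : R) 1 f df ->
    is_derive (0 : R) 1 g dg ->
    is_derive (0 : R) 1 (f * g) (f 0 * dg + g 0 * df).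
  by move=> hf hg; apply: is_derive_eq.
have dZ (f : R -> R) df r : is_derive (0 : R) 1 f df ->
    is_derive (0 : R) 1 (fun t => f t * r) (df * r).
  move=> hf.
  have -> : (fun t => f t * r) = r \*: f.
    by apply/funext => t /=; rewrite /GRing.scale/= mulrC.
  by apply: is_derive_eq; rewrite /GRing.scale/= mulrC.
(* The sine cross-ratio identity holds at every time t; this is its derivative at t = 0, where the
   flow is the identity. *)
have key x1 x2 x3 x4 :
    (c x1 x3 * (cos ((x2 - x4) / 2) * ((X x2 - X x4) / 2)) +
     c x2 x4 * (cos ((x1 - x3) / 2) * ((X x1 - X x3) / 2))) *
    (c x1 x4 * c x2 x3) =
    (c x1 x4 * (cos ((x2 - x3) / 2) * ((X x2 - X x3) / 2)) +
     c x2 x3 * (cos ((x1 - x4) / 2) * ((X x1 - X x4) / 2))) *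
    (c x1 x3 * c x2 x4).
  have hl := dZ _ _ (c x1 x4 * c x2 x3) (dM _ _ _ _ (dS x1 x3) (dS x2 x4)).
  have hr := dZ _ _ (c x1 x3 * c x2 x4) (dM _ _ _ _ (dS x1 x4) (dS x2 x3)).
  rewrite !S0 in hl hr.
  have E : (fun t => (S x1 x3 * S x2 x4) t * (c x1 x4 * c x2 x3)) =
           (fun t => (S x1 x4 * S x2 x3) t * (c x1 x3 * c x2 x4)).
    apply/funext => t.
    have [M [dM' hM]] := hPhi t.
    exact: (disc_diffeo_sin_cross_ratio _ _ _ x1 x2 x3 x4 dM' hM).
  rewrite E in hl.
  by rewrite -(@derive_val _ _ _ _ _ _ _ hl) -(@derive_val _ _ _ _ _ _ _ hr).
(* Three values of X determine it: the linearized cross-ratio relation at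
   0, pi, pi / 2, x expresses X x through X 0, X pi and X (pi / 2). *)
exists ((X 0 + X pi) / 2), ((X 0 - X pi) / 2),
  (X (pi / 2) - (X 0 + X pi) / 2).
apply/funext => x.
have := key 0 pi (pi / 2) x.
rewrite /c.
(* Half-angles make the relation polynomial in [p] and [q]; [r] is the common value of sine and
   cosine at pi / 4. *)
pose p := cos (x / 2); pose q := sin (x / 2); pose r : R := sin (pi / 4).
have rr : cos (pi / 4) = r.
  have := sinB (pi / 2) (pi / 4 : R).
  rewrite sin_pihalf cos_pihalf mul1r mul0r subr0 => <-.
  by rewrite /r; congr sin; field.
have r0 : r != 0.
  apply/eqP => r0; have := cos2Dsin2 (pi / 4 : R).
  by rewrite rr -/r r0 expr0n addr0 => /eqP; rewrite eq_sym oner_eq0.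
have -> : (0 - pi / 2) / 2 = - (pi / 4) :> R by field.
have -> : (pi - pi / 2) / 2 = pi / 4 :> R by field.
have -> : (0 - x) / 2 = - (x / 2) by field.
have -> : (pi - x) / 2 = pi / 2 - x / 2 by field.
rewrite sinB cosB !sinN !cosN sin_pihalf cos_pihalf rr -/r -/p -/q.
have x2 : x = x / 2 + x / 2 by field.
have cx : cos x = p ^+ 2 - q ^+ 2 by rewrite [in LHS]x2 cosD -/p -/q; ring.
have sx : sin x = 2 * p * q by rewrite [in LHS]x2 sinD -/p -/q; ring.
have pq : p ^+ 2 + q ^+ 2 = 1 by exact: cos2Dsin2.
move=> E; rewrite cx sx.
(* Multiplied by -2, the relation is linear in [X x] with coefficient r^2 (p^2 + q^2) = r^2, so it
   can be solved for every x without exception. *)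
have {}E : r ^+ 2 * (p ^+ 2 + q ^+ 2) * X x = r ^+ 2 *
   (p ^+ 2 * X 0 + q ^+ 2 * X pi - p * q * (X 0 + X pi - 2 * X (pi / 2))).
  move/eqP: E; rewrite -subr_eq0 => /eqP /(congr1 ( *%R (- 2))); rewrite mulr0 => E.
  by apply: subr0_eq; apply: etrans E; field.
have r20 : r ^+ 2 != 0 by rewrite expf_neq0.
move: E; rewrite pq mulr1 => /(mulfI r20) ->.
have -> : p ^+ 2 = 1 - q ^+ 2 by rewrite -pq; ring.
by field.
Qed.

(** * Integrals of sines and cosines over a period *)

Section CircleIntegral.
Context {R : realType}.
Implicit Types (f g phi : R -> R) (k l m : int) (a b : nat -> R) (N : nat).

Local Notation mu := (@lebesgue_measure R).
Local Notation I := [set` `[(0 : R), 2 * pi]].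
Local Notation itg f := (mu.-integrable I (EFin \o f)).
Local Notation Int f := (Rintegral mu I f).

Let mI : measurable I.
Proof. exact: measurable_itv. Qed.

Lemma continuous_itg f : continuous f -> itg f.
Proof.
move=> cf; apply: continuous_compact_integrable; first exact: segment_compact.
exact: continuous_subspaceT.
Qed.

Lemma itgZ (c : R) f : itg f -> itg (fun x => c * f x).
Proof.
move=> hf; have -> : EFin \o (fun x => c * f x) =
  (fun x => c%:E * (EFin \o f) x)%E by [].
exact: integrableZl.
Qed.

Lemma itgD f g : itg f -> itg g -> itg (fun x => f x + g x).
Proof.
move=> hf hg; have -> : EFin \o (fun x => f x + g x) =
  ((EFin \o f) \+ (EFin \o g))%E by [].
exact: integrableD.
Qed.

Lemma itg_sum (J : Type) (s : seq J) (h : J -> R -> R) :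
  (forall j, itg (h j)) -> itg (fun x => \sum_(j <- s) h j x).
Proof.
move=> ih.
have -> : EFin \o (fun x => \sum_(j <- s) h j x) =
          (fun x => \sum_(j <- s) (h j x)%:E)%E.
  by apply/funext => x /=; rewrite sumEFin.
by apply: integrable_sum => // j _; exact: ih.
Qed.

Lemma Rintegral_sum (J : Type) (s : seq J) (h : J -> R -> R) :
  (forall j, itg (h j)) ->
  Int (fun x => \sum_(j <- s) h j x) = \sum_(j <- s) Int (h j).
Proof.
move=> ih; elim: s => [|j s IHs].
  under eq_Rintegral do rewrite big_nil.
  by rewrite Rintegral_cst // mul0r big_nil.
under eq_Rintegral do rewrite big_cons.
by rewrite RintegralD ?itg_sum // IHs big_cons.
Qed.

(** The fundamental theorem of calculus gives F (2 pi) - F 0. This disposes of all nonzero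
    frequencies below. *)
Lemma Rintegral_periodic_derive f (F : R -> R) : continuous f ->
  (forall x : R, is_derive x 1 F (f x)) -> F (2 * pi) = F 0 -> Int f = 0.
Proof.
move=> cf dF F2.
have cF x : {for x, continuous F}.
  by apply: differentiable_continuous; apply/derivable1_diffP; apply: ex_derive.
rewrite /Rintegral (continuous_FTC2 (F := F)).
- by rewrite F2 subee.
- by rewrite mulr_gt0 ?pi_gt0.
- exact: continuous_subspaceT.
- split=> [x _||].
  + exact: ex_derive.
  + by apply: cvg_at_right_filter; exact: cF.
  + by apply: cvg_at_left_filter; exact: cF.
- by move=> x _; rewrite derive1E derive_val.
Qed.

Lemma is_derive_cosM (c x : R) :
  is_derive x 1 (fun y => cos (c * y)) (- (c * sin (c * x))).
Proof.
have -> : (fun y => cos (c * y)) = cos \o (c \*: id) by [].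
by apply: is_derive_eq; rewrite /GRing.scale/=; ring.
Qed.

Lemma is_derive_sinM (c x : R) :
  is_derive x 1 (fun y => sin (c * y)) (c * cos (c * x)).
Proof.
have -> : (fun y => sin (c * y)) = sin \o (c \*: id) by [].
by apply: is_derive_eq; rewrite /GRing.scale/=; ring.
Qed.

Lemma continuous_cosM (c : R) : continuous (fun y => cos (c * y)).
Proof.
move=> x; apply: differentiable_continuous; apply/derivable1_diffP.
by have := is_derive_cosM c x => h; apply: ex_derive.
Qed.

Lemma continuous_sinM (c : R) : continuous (fun y => sin (c * y)).
Proof.
move=> x; apply: differentiable_continuous; apply/derivable1_diffP.
by have := is_derive_sinM c x => h; apply: ex_derive.
Qed.

(** Parity reduces to k >= 0, where the period 2 pi is iterated k times. *)
Lemma cos_periodM k (x : R) : cos (k%:~R * (x + 2 * pi)) = cos (k%:~R * x).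
Proof.
wlog : k / 0 <= k => [hw|].
  have [/hw//|/ltW k0] := leP 0 k.
  by rewrite -cosN -[RHS]cosN -!mulNr -mulrNz hw // oppr_ge0.
case: k => // n _; rewrite mulrDr.
have -> : n%:~R * (2 * pi) = (pi *+ 2 *+ n) :> R.
  by rewrite -[RHS]mulr_natl -[pi *+ 2]mulr_natl.
by rewrite (periodicn (@cosD2pi R)).
Qed.

Lemma sin_periodM k (x : R) : sin (k%:~R * (x + 2 * pi)) = sin (k%:~R * x).
Proof.
wlog : k / 0 <= k => [hw|].
  have [/hw//|/ltW k0] := leP 0 k.
  by apply: oppr_inj; rewrite -!sinN -!mulNr -mulrNz hw // oppr_ge0.
case: k => // n _; rewrite mulrDr.
have -> : n%:~R * (2 * pi) = (pi *+ 2 *+ n) :> R.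
  by rewrite -[RHS]mulr_natl -[pi *+ 2]mulr_natl.
by rewrite (periodicn (@sinD2pi R)).
Qed.

Lemma Rintegral_cosM k :
  Int (fun x => cos (k%:~R * x)) = 2 * pi * (k == 0)%:R.
Proof.
have [->|k0] := eqVneq k 0.
  under eq_Rintegral do rewrite mul0r cos0.
  rewrite Rintegral_cst //= mul1r lebesgue_measure_itv /= lte_fin.
  by rewrite mulr_gt0 ?pi_gt0 //= subr0 mulr1.
rewrite mulr0; have kR : k%:~R != 0 :> R by rewrite intr_eq0.
apply: (@Rintegral_periodic_derive _ (fun x => k%:~R^-1 * sin (k%:~R * x))).
- exact: continuous_cosM.
- move=> x; have h := is_derive_sinM k%:~R x.
  have -> : (fun x => k%:~R^-1 * sin (k%:~R * x)) =
            k%:~R^-1 \*: (fun x => sin (k%:~R * x)) by [].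
  by apply: is_derive_eq; rewrite /GRing.scale/= mulrA mulVf // mul1r.
- by rewrite -[2 * pi]add0r sin_periodM.
Qed.

Lemma Rintegral_sinM k : Int (fun x => sin (k%:~R * x)) = 0.
Proof.
have [->|k0] := eqVneq k 0.
  under eq_Rintegral do rewrite mul0r sin0.
  by rewrite Rintegral_cst // mul0r.
have kR : k%:~R != 0 :> R by rewrite intr_eq0.
apply: (@Rintegral_periodic_derive _ (fun x => - k%:~R^-1 * cos (k%:~R * x))).
- exact: continuous_sinM.
- move=> x; have h := is_derive_cosM k%:~R x.
  have -> : (fun x => - k%:~R^-1 * cos (k%:~R * x)) =
            (- k%:~R^-1) \*: (fun x => cos (k%:~R * x)) by [].
  apply: is_derive_eq.
  by rewrite /GRing.scale/= mulNr mulrN opprK mulrA mulVf // mul1r.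
- by rewrite -[2 * pi]add0r cos_periodM.
Qed.

(** The shape of the product-to-sum formulas, used with c = 1 and c = -1. *)
Lemma Rintegral_halfD (c : R) f g : itg f -> itg g ->
  Int (fun x => (f x + c * g x) / 2) = (Int f + c * Int g) / 2.
Proof.
move=> hf hg; have hcg := itgZ c _ hg.
by rewrite RintegralZr ?RintegralD ?RintegralZl //; exact: itgD.
Qed.

(** The frequencies k - l and k + l can each vanish, whence two indicators; both are 1 when k = l =
    0, which gives 2 pi. *)
Lemma Rintegral_cosM_cosM k l :
  Int (fun x => cos (k%:~R * x) * cos (l%:~R * x)) =
  pi * ((k == l)%:R + (k == - l)%:R).
Proof.
transitivity (Int (fun x =>
    (cos ((k - l)%:~R * x) + 1 * cos ((k + l)%:~R * x)) / 2)).
  apply: eq_Rintegral => x _.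
  rewrite rmorphB rmorphD /= mulrBl [(_ + l%:~R) * _]mulrDl cosB cosD; by field.
rewrite Rintegral_halfD; try exact/continuous_itg/continuous_cosM.
by rewrite !Rintegral_cosM subr_eq0 addr_eq0; field.
Qed.

Lemma Rintegral_sinM_sinM k l :
  Int (fun x => sin (k%:~R * x) * sin (l%:~R * x)) =
  pi * ((k == l)%:R - (k == - l)%:R).
Proof.
transitivity (Int (fun x =>
    (cos ((k - l)%:~R * x) + (-1) * cos ((k + l)%:~R * x)) / 2)).
  apply: eq_Rintegral => x _.
  rewrite rmorphB rmorphD /= mulrBl [(_ + l%:~R) * _]mulrDl cosB cosD; by field.
rewrite Rintegral_halfD; try exact/continuous_itg/continuous_cosM.
by rewrite !Rintegral_cosM subr_eq0 addr_eq0; field.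
Qed.

Lemma Rintegral_sinM_cosM k l :
  Int (fun x => sin (k%:~R * x) * cos (l%:~R * x)) = 0.
Proof.
transitivity (Int (fun x =>
    (sin ((k - l)%:~R * x) + 1 * sin ((k + l)%:~R * x)) / 2)).
  apply: eq_Rintegral => x _.
  rewrite rmorphB rmorphD /= mulrBl [(_ + l%:~R) * _]mulrDl sinB sinD; by field.
rewrite Rintegral_halfD; try exact/continuous_itg/continuous_sinM.
by rewrite !Rintegral_sinM; field.
Qed.

(** * Trigonometric polynomials and their half Laplacian *)

(** Frequencies run from 0 to N - 1, so the length N = 2 gives the combinations of 1, cos and
    sin. *)
Definition trig_poly N a b (x : R) : R :=
  \sum_(n < N) (a n * cos (n%:~R * x) + b n * sin (n%:~R * x)).

Lemma is_derive_trig_poly N a b (x : R) :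
  is_derive x 1 (trig_poly N a b)
    (trig_poly N (fun n => n%:R * b n) (fun n => - (n%:R * a n)) x).
Proof.
have -> : trig_poly N a b = \sum_(n < N)
    (a n \*: (fun x => cos (n%:~R * x)) + b n \*: (fun x => sin (n%:~R * x))).
  by apply/funext => y; rewrite fct_sumE.
apply: is_derive_sum => n.
have dc := is_derive_cosM n%:~R x; have ds := is_derive_sinM n%:~R x.
by apply: is_derive_eq; rewrite /GRing.scale/= -!pmulrn; ring.
Qed.

Lemma derive1_trig_poly N a b :
  derive1 (trig_poly N a b) =
  trig_poly N (fun n => n%:R * b n) (fun n => - (n%:R * a n)).
Proof.
apply/funext => x; rewrite derive1E.
by have h := is_derive_trig_poly N a b x; rewrite derive_val.
Qed.

Lemma continuous_trig_poly N a b : continuous (trig_poly N a b).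
Proof.
move=> x; apply: differentiable_continuous; apply/derivable1_diffP.
by have h := is_derive_trig_poly N a b x; apply: ex_derive.
Qed.

(** Derivatives are again trigonometric polynomials, so the induction on the order runs over all
    coefficients at once. *)
Lemma smooth_trig_poly N a b : smooth_circle (trig_poly N a b).
Proof.
split=> [x|n].
  by apply: eq_bigr => n _; rewrite cos_periodM sin_periodM.
elim: n a b => [|n IHn] a b x.
  by have h := is_derive_trig_poly N a b x; apply: ex_derive.
by rewrite derive1Sn derive1_trig_poly.
Qed.

Lemma fun_distr_trig_poly N a b (phi : R -> R) : continuous phi ->
  fun_distr (trig_poly N a b) phi = \sum_(n < N)
    (a n * Int (fun x => cos (n%:~R * x) * phi x) +
     b n * Int (fun x => sin (n%:~R * x) * phi x)).
Proof.
move=> cphi; rewrite /fun_distr /trig_poly.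
have ic (n : nat) : itg (fun x => cos (n%:~R * x) * phi x).
  by apply: continuous_itg => x; apply: cvgM; [exact: continuous_cosM|exact: cphi].
have isn (n : nat) : itg (fun x => sin (n%:~R * x) * phi x).
  by apply: continuous_itg => x; apply: cvgM; [exact: continuous_sinM|exact: cphi].
transitivity (Int (fun x => \sum_(n < N)
    (a n * (cos (n%:~R * x) * phi x) + b n * (sin (n%:~R * x) * phi x)))).
  apply: eq_Rintegral => x _; rewrite mulr_suml; apply: eq_bigr => n _; ring.
rewrite Rintegral_sum => [|n]; last by apply: itgD; exact: itgZ.
apply: eq_bigr => n _.
have h1 := itgZ (a n) _ (ic n); have h2 := itgZ (b n) _ (isn n).
by rewrite RintegralD // !RintegralZl.
Qed.

Lemma fun_distr_trig_poly_cos N a b m :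
  fun_distr (trig_poly N a b) (fun x => cos (m%:~R * x)) =
  \sum_(n < N) pi * ((n%:Z == m)%:R + (n%:Z == - m)%:R) * a n.
Proof.
rewrite fun_distr_trig_poly; last exact: continuous_cosM.
by apply: eq_bigr => n _; rewrite Rintegral_cosM_cosM Rintegral_sinM_cosM; ring.
Qed.

Lemma fun_distr_trig_poly_sin N a b m :
  fun_distr (trig_poly N a b) (fun x => sin (m%:~R * x)) =
  \sum_(n < N) pi * ((n%:Z == m)%:R - (n%:Z == - m)%:R) * b n.
Proof.
rewrite fun_distr_trig_poly; last exact: continuous_sinM.
apply: eq_bigr => n _.
under [X in a n * X]eq_Rintegral do rewrite mulrC.
by rewrite Rintegral_sinM_sinM Rintegral_sinM_cosM; ring.
Qed.

(** The multiplier |n| of (-Delta)^(1/2), acting on cosine and sine coefficients indexed by natural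
    n. *)
Definition half_lap a n := n%:R * a n.

Lemma fracLap_trig_poly N a b :
  is_fracLap 2^-1 (fun_distr (trig_poly N a b))
    (fun_distr (trig_poly N (half_lap a) (half_lap b))).
Proof.
move=> m; rewrite /fourier !fun_distr_trig_poly_cos !fun_distr_trig_poly_sin.
rewrite mulfV ?pnatr_eq0 // powRr1 //.
(* Either indicator forces n = |m|, so the multiplier can be replaced by |m| and taken out of the
   sum. *)
have E (n : nat) : ((n%:Z == m)%:R * n%:R = (n%:Z == m)%:R * `|m%:~R| :> R) *
   ((n%:Z == - m)%:R * n%:R = (n%:Z == - m)%:R * `|m%:~R| :> R).
  split; case: eqP => [|_]; rewrite ?mul0r // => e; congr (_ * _).
    by rewrite -e normr_nat.
  by rewrite -normrN -mulrNz -e normr_nat.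
set c := `|_|.
have -> : \sum_(n < N) pi * ((n%:Z == m)%:R + (n%:Z == - m)%:R) * half_lap a n =
    c * \sum_(n < N) pi * ((n%:Z == m)%:R + (n%:Z == - m)%:R) * a n.
  rewrite mulr_sumr; apply: eq_bigr => n _; have [e1 e2] := E n.
  transitivity (pi * ((n%:Z == m)%:R * n%:R + (n%:Z == - m)%:R * n%:R) * a n).
    by rewrite /half_lap; ring.
  by rewrite e1 e2 /c; ring.
have -> : \sum_(n < N) pi * ((n%:Z == m)%:R - (n%:Z == - m)%:R) * half_lap b n =
    c * \sum_(n < N) pi * ((n%:Z == m)%:R - (n%:Z == - m)%:R) * b n.
  rewrite mulr_sumr; apply: eq_bigr => n _; have [e1 e2] := E n.
  transitivity (pi * ((n%:Z == m)%:R * n%:R - (n%:Z == - m)%:R * n%:R) * b n).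
    by rewrite /half_lap; ring.
  by rewrite e1 e2 /c; ring.
by apply/eqP; rewrite eq_complex /=; apply/andP; split; apply/eqP; ring.
Qed.

Lemma ltn_absz_neq N (n : 'I_N) m : (N <= `|m|)%N -> (n%:Z == m) = false.
Proof.
by move=> Nm; apply: contraTF Nm => /eqP <-; rewrite absz_nat -ltnNge.
Qed.

(** Serves twice: with N = 2 against the vector field, and with general N for the coefficients of a
    truncation error. *)
Lemma fun_distr_trig_poly_cos_ge N a b m : (N <= `|m|)%N ->
  fun_distr (trig_poly N a b) (fun x => cos (m%:~R * x)) = 0.
Proof.
move=> Nm; rewrite fun_distr_trig_poly_cos big1 // => n _.
rewrite !ltn_absz_neq ?abszN //.
by rewrite addr0 mulr0 mul0r.
Qed.

Lemma fun_distr_trig_poly_sin_ge N a b m : (N <= `|m|)%N ->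
  fun_distr (trig_poly N a b) (fun x => sin (m%:~R * x)) = 0.
Proof.
move=> Nm; rewrite fun_distr_trig_poly_sin big1 // => n _.
rewrite !ltn_absz_neq ?abszN //.
by rewrite subr0 mulr0 mul0r.
Qed.

(** * Orthogonality of the product to frequencies below 2 *)

(** The real form of the computation of Im (F^2): the product expands into a double sum over (n, m)
    whose integrated terms are antisymmetric. *)
Lemma half_lap_derive_orthogonal N a b (c d : nat -> R) :
  fun_distr (fun x => trig_poly N (half_lap a) (half_lap b) x *
                      derive1 (trig_poly N a b) x) (trig_poly 2 c d) = 0.
Proof.
rewrite derive1_trig_poly.
have [X eX] : exists X, X = trig_poly 2 c d by exists (trig_poly 2 c d).
have cX : continuous X by rewrite eX; exact: continuous_trig_poly.
rewrite -eX.
pose A (n : nat) (x : R) :=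
  half_lap a n * cos (n%:~R * x) + half_lap b n * sin (n%:~R * x).
pose B (n : nat) (x : R) :=
  n%:R * b n * cos (n%:~R * x) + - (n%:R * a n) * sin (n%:~R * x).
pose h (n m : nat) (x : R) := A n x * B m x * X x.
have clin (p q : R) (n : nat) :
    continuous (fun x : R => p * cos (n%:~R * x) + q * sin (n%:~R * x)).
  move=> x; apply: cvgD; apply: cvgM; try exact: cvg_cst.
    exact: continuous_cosM.
  exact: continuous_sinM.
have ih (n m : nat) : itg (h n m).
  apply: continuous_itg => x.
  apply: cvgM; last exact: cX.
  by apply: cvgM; exact: clin.
have E : fun_distr (fun x => trig_poly N (half_lap a) (half_lap b) x *
      trig_poly N (fun n => n%:R * b n) (fun n => - (n%:R * a n)) x) X =
    \sum_(n < N) \sum_(m < N) Int (h n m).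
  rewrite /fun_distr.
  transitivity (Int (fun x => \sum_(n < N) \sum_(m < N) h n m x)).
    apply: eq_Rintegral => x _ /=; rewrite /trig_poly; rewrite !mulr_suml.
    apply: eq_bigr => n _; rewrite mulr_sumr mulr_suml.
    by apply: eq_bigr.
  rewrite Rintegral_sum => [|n]; last by exact: itg_sum.
  by apply: eq_bigr => n _; rewrite Rintegral_sum.
(* Exchanging n and m leaves only the frequency n + m, which is at least 2
   unless the term vanishes. *)
have anti (n m : nat) : Int (h n m) + Int (h m n) = 0.
  rewrite -(RintegralD _ (ih n m) (ih m n)) //.
  have ic : itg (fun x => X x * cos ((n%:Z + m%:Z)%:~R * x)).
    apply: continuous_itg => x; apply: cvgM; first exact: cX.
    exact: continuous_cosM.
  have isn : itg (fun x => X x * sin ((n%:Z + m%:Z)%:~R * x)).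
    apply: continuous_itg => x; apply: cvgM; first exact: cX.
    exact: continuous_sinM.
  (* Since A n + i B n = n (a n + i b n) e^(-inx), the sum A n B m + A m B n is the imaginary part
     of n m (a n + i b n) (a m + i b m) e^(-i(n+m)x); [C1] and [C2] are its cosine and sine
     coefficients. *)
  pose C1 := n%:R * m%:R * (a n * b m + a m * b n).
  pose C2 := n%:R * m%:R * (b n * b m - a n * a m).
  transitivity (Int (fun x => C1 * (X x * cos ((n%:Z + m%:Z)%:~R * x)) +
                              C2 * (X x * sin ((n%:Z + m%:Z)%:~R * x)))).
    apply: eq_Rintegral => x _.
    have -> : (n%:Z + m%:Z)%:~R * x = n%:~R * x + m%:~R * x.
      by rewrite intrD mulrDl.
    by rewrite /h /A /B /C1 /C2 /half_lap cosD sinD; ring.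
  have i1 := itgZ C1 _ ic; have i2 := itgZ C2 _ isn.
  rewrite RintegralD // !RintegralZl //.
  have [nm0|] := eqVneq (n * m)%N 0%N.
    by rewrite /C1 /C2 -natrM nm0 !mul0r addr0.
  rewrite muln_eq0 negb_or -!lt0n => /andP[n0 m0].
  have nm2 : (2 <= `|(n%:Z + m%:Z)%R|)%N.
    by rewrite -PoszD absz_nat (leq_add n0 m0).
  have e1 : Int (fun x => X x * cos ((n%:Z + m%:Z)%:~R * x)) = 0.
    by rewrite eX; exact: (fun_distr_trig_poly_cos_ge 2 c d _ nm2).
  have e2 : Int (fun x => X x * sin ((n%:Z + m%:Z)%:~R * x)) = 0.
    by rewrite eX; exact: (fun_distr_trig_poly_sin_ge 2 c d _ nm2).
  by rewrite e1 e2 !mulr0 addr0.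
rewrite E; set S := \sum_(n < N) _.
(* Swapping the indices in one copy of [S] pairs [h n m] with [h m n], and [anti] cancels each
   pair. *)
suff : S + S = 0 by move/eqP; rewrite -mulr2n mulrn_eq0 /= => /eqP.
rewrite {1}/S exchange_big /= -big_split big1 // => n _ /=.
by rewrite -big_split big1 // => m _ /=.
Qed.

End CircleIntegral.

(** * Convergence of Fourier partial sums in H^(1/2) *)

(** Grouping the integers by absolute value turns the sum into the tail of a convergent series of
    nonnegative terms over the naturals. *)
Lemma esum_int_tail_cvg (R : realType) (f : int -> \bar R) :
  (forall m, (0 <= f m)%E) -> (\esum_(m in [set: int]) f m < +oo)%E ->
  \esum_(m in [set: int]) (if (`|m| < N)%N then 0%E else f m) @[N --> \oo]
    --> 0%E.
Proof.
move=> f0 foo.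
pose F (n : nat) : set int := [set m | `|m|%N = n].
have FT : \bigcup_n F n = [set: int].
  by apply/seteqP; split=> // m _; exists `|m|%N.
have tF : trivIset setT F by move=> i j _ _ [m [/= <- <-]].
pose g n := (\esum_(m in F n) f m)%E.
have g0 n : (0 <= g n)%E by apply: esum_ge0.
have -> : (fun N : nat => (\esum_(m in [set: int])
              (if (`|m| < N)%N then 0 else f m))%E) =
          (fun N : nat => \sum_(N <= n <oo) g n)%E.
  apply/funext => N.
  rewrite -FT nneseries_sum_bigcup // => [|m]; last by case: ifP.
  rewrite [RHS]ereal_series [RHS]eseries_mkcond; apply: eq_eseriesr => n _.
  case: leqP => nN; first by apply: eq_esum => m /= ->; rewrite ltnNge nN.
  by apply: esum1 => m /= ->; rewrite nN.
apply: nneseries_tail_cvg => //.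
by rewrite /g -nneseries_sum_bigcup // FT.
Qed.

Section FourierTruncation.
Context {R : realType}.
Implicit Types (N : nat) (m : int).

Local Notation mu := (@lebesgue_measure R).
Local Notation I := [set` `[(0 : R), 2 * pi]].
Local Notation itg f := (mu.-integrable I (EFin \o f)).

Context (f : R -> R) (mf : measurable_fun setT f)
  (f2 : mu.-integrable I (fun x => ((f x) ^+ 2)%:E)).

(** Domination on a bounded interval: |f phi| <= |f| <= 1 + f^2, the last bound coming from (|f| -
    1/2)^2 >= 0. *)
Lemma square_integrableM (phi : R -> R) : continuous phi ->
  (forall x, `|phi x| <= 1) -> itg (fun x => f x * phi x).
Proof.
move=> cphi phi1.
have mI : measurable I by exact: measurable_itv.
have i1 : itg (fun x => 1 + f x ^+ 2).
  apply: (@itgD R (fun=> 1) (fun x => f x ^+ 2)) => //.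
  by apply: continuous_itg => x; exact: cvg_cst.
apply: le_integrable i1 => //.
  apply/measurable_EFinP; apply: measurable_funM.
    exact: measurable_funTS.
  by apply: measurable_funTS; exact: continuous_measurable_fun.
move=> x _ /=; rewrite lee_fin normrM.
have h0 : 0 <= f x ^+ 2 by exact: sqr_ge0.
rewrite [leRHS]ger0_norm; last by lra.
apply: (@le_trans _ _ `|f x|).
  by rewrite -[leRHS]mulr1 ler_wpM2l.
have := sqr_ge0 (`|f x| - 2^-1).
rewrite sqrrB real_normK ?num_real //.
lra.
Qed.

(** The denominator is the integral of cos^2 (n x) over a period: pi, but 2 pi at n = 0. *)
Definition cos_coef (n : nat) : R :=
  fun_distr f (fun x => cos (n%:~R * x)) / (pi * (1 + (n == 0%N)%:R)).
Definition sin_coef (n : nat) : R :=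
  fun_distr f (fun x => sin (n%:~R * x)) / pi.

Definition fourier_trunc N := trig_poly N cos_coef sin_coef.

Let itg_cos m : itg (fun x => f x * cos (m%:~R * x)).
Proof.
apply: square_integrableM => [|x]; first exact: continuous_cosM.
exact: cos_max.
Qed.

Let itg_sin m : itg (fun x => f x * sin (m%:~R * x)).
Proof.
apply: square_integrableM => [|x]; first exact: continuous_sinM.
exact: sin_max.
Qed.

Lemma fun_distr_truncB N (phi : R -> R) : continuous phi ->
  itg (fun x => f x * phi x) ->
  fun_distr (fun x => fourier_trunc N x - f x) phi =
  fun_distr (fourier_trunc N) phi - fun_distr f phi.
Proof.
move=> cphi ifp; rewrite /fun_distr -RintegralB //.
  by apply: eq_Rintegral => x _; rewrite mulrBl.
apply: continuous_itg => x.
by apply: cvgM; [exact: continuous_trig_poly|exact: cphi].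
Qed.

Let pi_neq0 : pi != 0 :> R.
Proof. by rewrite gt_eqF // pi_gt0. Qed.

Lemma fourier_trunc_cos_nat N (n : nat) : (n < N)%N ->
  fun_distr (fourier_trunc N) (fun x => cos (n%:~R * x)) =
  fun_distr f (fun x => cos (n%:~R * x)).
Proof.
move=> nN; rewrite fun_distr_trig_poly_cos (bigD1 (Ordinal nN)) //= big1 ?addr0.
  rewrite eqxx /cos_coef; move: (fun_distr f _) pi_neq0.
  move: (pi : R) => p F p0.
  (* At n = 0 both indicators are 1, and their sum matches the doubled denominator of [cos_coef]. *)
  by case: n nN => [|n] nN /=; field; rewrite p0.
move=> i; rewrite -val_eqE /= => /negbTE ni.
rewrite eqz_nat ni; case: n {nN} ni => [|n] ni.
  by rewrite oppr0 eqz_nat ni addr0 mulr0 mul0r.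
by rewrite addr0 mulr0 mul0r.
Qed.

Lemma fourier_trunc_sin_nat N (n : nat) : (n < N)%N ->
  fun_distr (fourier_trunc N) (fun x => sin (n%:~R * x)) =
  fun_distr f (fun x => sin (n%:~R * x)).
Proof.
move=> nN; rewrite fun_distr_trig_poly_sin (bigD1 (Ordinal nN)) //= big1 ?addr0.
  rewrite eqxx /sin_coef; case: n nN => [|n] nN /=.
    rewrite subrr mulr0 mul0r /fun_distr.
    under eq_Rintegral do rewrite mul0r sin0 mulr0.
    by rewrite Rintegral_cst // mul0r.
  move: (fun_distr f _) pi_neq0.
  by move: (pi : R) => p F p0; field.
move=> i; rewrite -val_eqE /= => /negbTE ni.
rewrite eqz_nat ni; case: n {nN} ni => [|n] ni.
  by rewrite oppr0 eqz_nat ni subr0 mulr0 mul0r.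
by rewrite subr0 mulr0 mul0r.
Qed.

Let fun_distr_sinN (h : R -> R) m : itg (fun x => h x * sin (m%:~R * x)) ->
  fun_distr h (fun x => sin ((- m)%:~R * x)) =
  - fun_distr h (fun x => sin (m%:~R * x)).
Proof.
move=> ih; rewrite /fun_distr -[RHS]mulN1r -RintegralZl //.
by apply: eq_Rintegral => x _; rewrite mulrNz mulNr sinN; ring.
Qed.

(** Below N the truncation has the cosine and sine integrals of f; parity carries this from natural
    to negative frequencies. *)
Lemma fourier_trunc_lt N m : (`|m| < N)%N ->
  fourier (fun_distr (fun x => fourier_trunc N x - f x)) m = 0.
Proof.
move=> mN; rewrite /fourier !fun_distr_truncB //;
  try exact: continuous_cosM; try exact: continuous_sinM.
have -> : fun_distr (fourier_trunc N) (fun x => cos (m%:~R * x)) =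
          fun_distr f (fun x => cos (m%:~R * x)).
  have -> : (fun x : R => cos (m%:~R * x)) = (fun x => cos (`|m|%N%:~R * x)).
    apply/funext => x; case: (intP m) => // n.
    by rewrite abszN absz_nat mulrNz mulNr cosN.
  exact: fourier_trunc_cos_nat.
have -> : fun_distr (fourier_trunc N) (fun x => sin (m%:~R * x)) =
          fun_distr f (fun x => sin (m%:~R * x)).
  case: (intP m) mN => [|n|n]; rewrite ?abszN ?absz_nat => nN;
    try exact: fourier_trunc_sin_nat.
  rewrite !fun_distr_sinN //; first by rewrite fourier_trunc_sin_nat.
  apply: continuous_itg => x.
  by apply: cvgM; [exact: continuous_trig_poly|exact: continuous_sinM].
by rewrite !subrr mul0r oppr0.
Qed.

(** The truncation has no such frequency, so the coefficient of the error is that of -f, and the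
    modulus drops the sign. *)
Lemma normc_fourier_trunc_ge N m : (N <= `|m|)%N ->
  ComplexField.Normc.normc
    (fourier (fun_distr (fun x => fourier_trunc N x - f x)) m) =
  ComplexField.Normc.normc (fourier (fun_distr f) m).
Proof.
move=> mN; rewrite /fourier !fun_distr_truncB //;
  try exact: continuous_cosM; try exact: continuous_sinM.
rewrite fun_distr_trig_poly_cos_ge // fun_distr_trig_poly_sin_ge // !sub0r /=.
by congr Num.sqrt; ring.
Qed.

End FourierTruncation.

(** In each component the squared norm of the error is the part |m| >= N of a convergent sum, hence
    a vanishing tail. *)
Lemma fourier_trunc_sobolev_cvg (R : realType) (k : nat) (u : R -> 'rV[R]_k) :
  sobolev 2^-1 u ->
  sobolev_cvg 2^-1
    (fun N x => \row_j fourier_trunc (component u j) N x) u.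
Proof.
move=> [_ mu u2 unorm]; rewrite /sobolev_cvg /sobolev_norm2.
pose w (m : int) : R := (1 + (m%:~R : R) ^+ 2) `^ 2^-1.
pose f j (m : int) := (w m * ComplexField.Normc.normc
   (fourier (fun_distr (component u j)) m) ^+ 2)%:E.
have f0 j m : (0 <= f j m)%E.
  by rewrite lee_fin mulr_ge0 ?powR_ge0 // sqr_ge0.
have foo j : (\esum_(m in [set: int]) f j m < +oo)%E.
  apply: le_lt_trans unorm; rewrite /sobolev_norm2 (bigD1 j) //=.
  rewrite -[leLHS]adde0 leeD2l // sume_ge0 // => i _.
  by apply: esum_ge0 => m _; exact: f0.
have -> : (fun N : nat => (\sum_(j < k) \esum_(m in [set: int])
     (w m * ComplexField.Normc.normc (fourier (fun_distr (component
       (fun x => \row_j fourier_trunc (component u j) N x - u x) j))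
       m) ^+ 2)%:E)%E) =
   (fun N : nat => (\sum_(j < k) \esum_(m in [set: int])
     (if (`|m| < N)%N then 0 else f j m))%E).
  apply/funext => N; apply: eq_bigr => j _; apply: eq_esum => m _.
  have -> : component (fun x => \row_j fourier_trunc (component u j) N x - u x) j =
            (fun x => fourier_trunc (component u j) N x - component u j x).
    by apply/funext => x; rewrite /component !mxE.
  case: ltnP => mN.
    by rewrite fourier_trunc_lt // ComplexField.Normc.normc0 expr0n mulr0.
  by rewrite normc_fourier_trunc_ge.
pose e (j : 'I_k) (N : nat) :=
  (\esum_(m in [set: int]) (if (`|m| < N)%N then 0 else f j m))%E.
have : (\sum_(j < k) e j N)%E @[N --> \oo] --> (\sum_(j < k) 0 : \bar R)%E.
  apply: (@cvg_nnesum _ _ _ R _ _ e (fun=> 0%E) xpredT) => j _.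
    by near=> N; apply: esum_ge0 => m _; case: ifP.
  exact: esum_int_tail_cvg.
by rewrite big1.
Unshelve. all: by end_near.
Qed.

(** * Passage to the limit along the partial sums *)

Theorem lemma4p5 (R : realType) (k : nat) (hk : (1 <= k)%N) (X : R -> R)
    (hX : smooth_circle X) (hflow : flow_of_disc_diffeos X)
    (u : R -> 'rV[R]_k) (hu : sobolev 2^-1 u)
    (V : (R -> R) -> R) (hV : is_V12 u V) :
  V X = 0.
Proof.
have [al [be [ga XE]]] := flow_of_disc_diffeos_trig R X hflow.
(* Coefficients of X as a trigonometric polynomial of length 2; [d] can be constant because its
   value at 0 multiplies sin 0. *)
pose c n : R := if n is 0%N then al else be.
pose d (n : nat) : R := ga.
have {}XE : X = trig_poly 2 c d.
  rewrite XE; apply/funext => x; rewrite /trig_poly !big_ord_recl big_ord0 /=.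
  by rewrite mul0r cos0 sin0 !mul1r /d; ring.
pose un N x : 'rV[R]_k := \row_j fourier_trunc (component u j) N x.
(* The half Laplacian of [un N], the witness that [is_V12_smooth] asks for. *)
pose gn N x : 'rV[R]_k := \row_j trig_poly N
  (half_lap (cos_coef (component u j))) (half_lap (sin_coef (component u j))) x.
have unE N j : component (un N) j = fourier_trunc (component u j) N.
  by apply/funext => x; rewrite /component mxE.
have gnE N j : component (gn N) j = trig_poly N
  (half_lap (cos_coef (component u j))) (half_lap (sin_coef (component u j))).
  by apply/funext => x; rewrite /component mxE.
pose wn N x := \sum_(j < k) component (gn N) j x * derive1 (component (un N) j) x.
have [_ /(_ un wn)] := hV.
move=> /(_ _ (fourier_trunc_sobolev_cvg _ _ _ hu)).
have smooth_un N : smooth_map (un N).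
  by move=> j; rewrite unE; exact: smooth_trig_poly.
have V_un N : is_V12_smooth (un N) (wn N).
  exists (gn N); split=> // j; first by rewrite gnE; exact: smooth_trig_poly.
  by rewrite unE gnE; exact: fracLap_trig_poly.
move=> /(_ smooth_un V_un X hX).
(* Each approximating pairing is exactly 0, component by component, so uniqueness of limits yields
   [V X = 0]. *)
have -> : (fun N => fun_distr (wn N) X) = (fun=> 0).
  apply/funext => N.
  transitivity (\sum_(j < k) fun_distr (fun x => component (gn N) j x *
     derive1 (component (un N) j) x) X).
    rewrite /fun_distr -Rintegral_sum => [|j].
      by apply: eq_Rintegral => x _; rewrite mulr_suml.
    apply: continuous_itg => x; rewrite unE gnE derive1_trig_poly XE.
    by apply: cvgM; [apply: cvgM|]; exact: continuous_trig_poly.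
  rewrite big1 // => j _; rewrite unE gnE XE.
  exact: half_lap_derive_orthogonal.
by move=> /(cvg_unique _ (cvg_cst _)) ->.
Qed.
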